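(* For every positive integer $m$, $\mathsf{s}_{2m}(\mathbb{Z}_2^{2m}) = 4m+1$.
   Context: For a positive integer $m$ and a nonnegative integer $d$, $\mathsf{s}_{2m}(\mathbb{Z}_2^d)$ denotes the smallest integer $s$ such that every sequence (repetitions allowed) of length $s$ of elements of the group $\mathbb{Z}_2^d$ has a subsequence of length $2m$ whose elements sum to $0$. *)

(* Defs.v *)
From HB Require Import structures.
From mathcomp Require Import all_boot all_order all_algebra.
Set Implicit Arguments.
Unset Strict Implicit.
Unset Printing Implicit Defensive.
Import GRing.Theory.
Local Open Scope ring_scope.

(* Z_2^d is the additive group of 'rV['F_2]_d. In [subseq], terms keep their
   multiplicity and need not be contiguous. *)
Definition has_zero_sum (m d n : nat) : bool :=
  [forall S : n.-tuple 'rV['F_2]_d,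
    [exists T : (2 * m).-tuple 'rV['F_2]_d,
      subseq T S && (\sum_(x <- T) x == 0)]].

(* By pigeonhole, a long enough sequence takes some value at least 2m times. *)
Lemma has_zero_sum_exists (m d : nat) : exists n, has_zero_sum m d n.
Proof.
exists (#|{: 'rV['F_2]_d}| * (2 * m)).+1.
apply/forallP => S.
have [x Hx] : exists x, (2 * m <= count_mem x S)%N.
  apply/existsP; apply: contraT; rewrite negb_exists => /forallP H.
  have : (#|{: 'rV['F_2]_d}| * (2 * m) < \sum_(x <- S) 1)%N.
    by rewrite sum1_size size_tuple.
  rewrite (partition_big (fun x : 'rV['F_2]_d => x) predT) //=.
  move=> E; have : (#|{: 'rV['F_2]_d}| * (2 * m) < #|{: 'rV['F_2]_d}| * (2 * m))%N.
    apply: leq_trans E _.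
    apply: (@leq_trans (\sum_(x : 'rV['F_2]_d) 2 * m)%N).
      apply: leq_sum => x _.
      by rewrite sum1_count ltnW // ltnNge H.
    by rewrite sum_nat_const.
  by rewrite ltnn.
apply/existsP; exists (nseq_tuple (2 * m) x); apply/andP; split.
  apply: (@subseq_trans _ (filter (pred1 x) S)); last exact: filter_subseq.
  have /all_pred1P -> : all (pred1 x) (filter (pred1 x) S) by apply: filter_all.
  rewrite size_filter /= -(subnKC Hx) nseqD.
  exact: prefix_subseq.
apply/eqP; rewrite /= big_nseq .
have -> : iter (2 * m) (+%R x) 0 = x *+ (2 * m) by rewrite -iter_addr_0.
have -> : x *+ (2 * m) = ((2%:R : 'F_2) *: x) *+ m by rewrite mulrnA scaler_nat.
have -> : (2%:R : 'F_2) = 0 by apply/val_inj.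
by rewrite scale0r mul0rn.
Qed.

(* s_{2m}(Z_2^d). *)
Definition s2m (m d : nat) : nat := ex_minn (has_zero_sum_exists m d).

(* Main.v *)
(** Upper bound: among [4m+1] terms, choose a largest family of disjoint pairs
    [(a_i, b_i)] whose differences [a_i + b_i] are independent, and let [W] be
    the span of these [r] differences.  If [r < 2m], at least three terms are
    unpaired, and an exchange argument shows that all the terms lie in a single
    coset of [W]; if [r = 2m], then [W] is the whole group.  Pick one term of
    each pair and [2m - r] unpaired terms: as [2m] is even the sum is in [W],
    and swapping [a_i] for [b_i] in suitable pairs makes it zero.

    Lower bound: the sequence made of [2m-1] zeros, the unit vectors and their
    sum has length [4m].  Besides subsequences of zeros, its zero-sum
    subsequences contain the [2m+1] nonzero terms. *)

Require Import Defs.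
From mathcomp Require Import all_boot all_order all_algebra.
From mathcomp Require Import zify.

Import GRing.Theory.

Section PairedSequences.

Set Implicit Arguments.
Unset Strict Implicit.
Unset Printing Implicit Defensive.
Local Open Scope ring_scope.

Variable d : nat.
Notation V := 'rV['F_2]_d.

Implicit Types (x y z v w : V) (S R L : seq V) (P Q : seq (V * V)).

Lemma F2_cases (k : 'F_2) : k = 0 \/ k = 1.
Proof. by case: k => [[|[|//]] lk]; [left | right]; apply/val_inj. Qed.

Lemma addvv x : x + x = 0.
Proof. by apply/rowP => i; rewrite !mxE; case: (F2_cases (x 0 i)) => ->; apply/val_inj. Qed.

Lemma addKvv x y : x + (x + y) = y.
Proof. by rewrite addrA addvv add0r. Qed.

(** In characteristic 2 the sum of two vectors is also their difference. *)
Definition differences P : seq V := [seq p.1 + p.2 | p <- P].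

Definition pairing S P R : bool :=
  perm_eq S (unzip1 P ++ unzip2 P ++ R) && free (differences P).

Lemma mem_span_cons x (X : seq V) w :
  w \in <<x :: X>>%VS -> w \in <<X>>%VS \/ x + w \in <<X>>%VS.
Proof.
rewrite span_cons => /memv_addP[_ /vlineP[k ->] [u uX ->]].
case: (F2_cases k) => ->; first by left; rewrite scale0r add0r.
by right; rewrite scale1r addKvv.
Qed.

Lemma pairing_add S P R y z :
    pairing S P (y :: z :: R) -> y + z \notin <<differences P>>%VS ->
  pairing S ((y, z) :: P) R.
Proof.
move=> /andP[SP fP] yzP; rewrite /pairing /= free_cons yzP fP !andbT.
apply: (perm_trans SP); apply/permP => a; rewrite /= !count_cat /=.
by rewrite ?count_cat /=; lia.
Qed.

(** Over ['F_2], two vectors are independent modulo a subspace once neither they nor their sum lie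
    in it; here the two new differences add up to [(p.1 + p.2) + (y + z)]. *)
Lemma pairing_exchange S p Q R y z :
    pairing S (p :: Q) (y :: z :: R) -> p.2 + z \notin <<differences Q>>%VS ->
    p.1 + y \notin <<differences Q>>%VS ->
    (p.1 + p.2) + (y + z) \notin <<differences Q>>%VS ->
  pairing S [:: (p.1, y), (p.2, z) & Q] R.
Proof.
move=> /andP[SP]; rewrite /= free_cons => /andP[_ fQ] pz py pyz.
rewrite /pairing /= !free_cons pz fQ !andbT; apply/andP; split.
  apply: (perm_trans SP); apply/permP => a; rewrite /= !count_cat /=.
  by rewrite ?count_cat /=; lia.
apply/negP => /mem_span_cons[]; first exact/negP.
by rewrite addrC addrACA; exact/negP.
Qed.

Lemma pairing_permr S P R R' : perm_eq R R' -> pairing S P R -> pairing S P R'.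
Proof.
move=> RR' /andP[SP fP]; rewrite /pairing fP andbT.
by apply: (perm_trans SP); rewrite !perm_cat2l.
Qed.

Lemma pairing_perml S P P' R : perm_eq P P' -> pairing S P R -> pairing S P' R.
Proof.
move=> PP' /andP[SP fP]; apply/andP; split; last first.
  by rewrite -(perm_free (perm_map _ PP')).
apply: (perm_trans SP); rewrite perm_cat ?perm_map //.
by rewrite perm_cat ?perm_map.
Qed.

Lemma size_pairing S P R : pairing S P R -> size S = ((size P).*2 + size R)%N.
Proof.
move=> /andP[/perm_size -> _].
by rewrite !size_cat !size_map addnA addnn.
Qed.

Lemma pairing_leq_dim S P R : pairing S P R -> (size P <= d)%N.
Proof.
move=> /andP[_ /eqP fP]; rewrite -(size_map (fun p => p.1 + p.2)) -fP.
by apply: leq_trans (dimvS (subvf _)) _; rewrite dimvf /dim /= mul1n.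
Qed.

(** An unpaired term not congruent to [y1] modulo the span can be paired with [y1]. Failing that, a
    pair [p] with [p.1] not congruent to [y1] is broken up, and its two terms are matched with two
    of three unpaired ones. If neither applies, all terms lie in the coset of [y1]. *)
Lemma pairing_extend S P R :
    pairing S P R -> (2 < size R)%N ->
  (exists P' R', pairing S P' R' /\ size P' = (size P).+1) \/
  (exists v, {in S, forall x, x + v \in <<differences P>>%VS}).
Proof.
case: R => [|y1 [|y2 [|y3 R]]] // SPR _.
set W := <<_>>%VS.
have [/hasP[z zR zW]|/hasPn RW] :=
    boolP (has (fun z => y1 + z \notin W) [:: y2, y3 & R]).
  left; exists ((y1, z) :: P), (rem z [:: y2, y3 & R]); split=> //.
  apply: pairing_add => //; apply: pairing_permr SPR.
  by rewrite perm_cons perm_to_rem.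
have {}RW : {in [:: y1, y2, y3 & R], forall z, y1 + z \in W}.
  move=> z; rewrite inE => /predU1P[->|/RW /negPn //].
  by rewrite addvv mem0v.
have [/hasP[p pP pW]|/hasPn PW] := boolP (has (fun p => p.1 + y1 \notin W) P).
  left; pose Q := rem p P.
  have PQ : perm_eq P (p :: Q) by apply: perm_to_rem.
  have sQ : (size P).+1 = (size Q).+2 by rewrite (perm_size PQ).
  have {SPR} SQR := pairing_perml PQ SPR.
  have WE : W = <<(p.1 + p.2)%R :: differences Q>>%VS.
    by apply: eq_span; apply/perm_mem; apply: (perm_map _ PQ).
  have QW x : x \in <<differences Q>>%VS -> x \in W.
    by rewrite WE span_cons; apply/subvP/addvSr.
  have p12W : p.1 + p.2 \in W by rewrite WE memv_span ?mem_head.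
  (* Modulo [W] the unpaired terms are all congruent to [y1], hence none to [p.1], nor to [p.2]
     since [p.1 + p.2] is in [W]; this persists modulo the smaller span. *)
  have p1Q z : z \in [:: y1, y2, y3 & R] -> p.1 + z \notin <<differences Q>>%VS.
    move=> /RW zW; apply: contra pW => /QW pzW.
    by have := memvD pzW zW; rewrite addrACA addvv addr0.
  have p2Q z : z \in [:: y1, y2, y3 & R] -> p.2 + z \notin <<differences Q>>%VS.
    move=> /RW zW; apply: contra pW => /QW pzW.
    have := memvD p12W (memvD pzW zW).
    by rewrite [_ + (y1 + z)]addrACA addvv addr0 -addrA addKvv.
  have p12Q : p.1 + p.2 \notin <<differences Q>>%VS.
    by case/andP: SQR => _; rewrite /= free_cons => /andP[].
  (* The three sums [p.1 + p.2 + (y_i + y_j)] add up to [p.1 + p.2]. *)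
  have [yz12|yz12] := boolP ((p.1 + p.2) + (y1 + y2) \in <<differences Q>>%VS); last first.
    exists [:: (p.1, y1), (p.2, y2) & Q], (y3 :: R); split=> //.
    by apply: pairing_exchange SQR _ _ yz12; rewrite ?p1Q ?p2Q ?inE ?eqxx ?orbT.
  have [yz13|yz13] := boolP ((p.1 + p.2) + (y1 + y3) \in <<differences Q>>%VS); last first.
    exists [:: (p.1, y1), (p.2, y3) & Q], (y2 :: R); split=> //.
    apply: pairing_exchange _ _ _ yz13; rewrite ?p1Q ?p2Q ?inE ?eqxx ?orbT //.
    apply: pairing_permr SQR; rewrite perm_cons.
    by apply/permP => a /=; lia.
  exists [:: (p.1, y2), (p.2, y3) & Q], (y1 :: R); split=> //.
  apply: pairing_exchange; rewrite ?p1Q ?p2Q ?inE ?eqxx ?orbT //.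
    by apply: pairing_permr SQR; apply/permP => a /=; lia.
  apply: contra p12Q => yz23; have := memvD (memvD yz12 yz13) yz23.
  by rewrite [X in X + _]addrACA addvv add0r [X in X + _]addrACA addvv add0r addrCA addvv addr0.
right; exists y1 => x; have /andP[SP _] := SPR.
rewrite (perm_mem SP) !mem_cat => /or3P[/mapP[p pP ->]|/mapP[p pP ->]|xR].
- exact/negPn/PW.
- have := memvD (negPn (PW p pP)) (memv_span (map_f (fun p => p.1 + p.2) pP)).
  by rewrite addrACA addvv add0r addrC.
- by rewrite addrC RW.
Qed.

(** Each extension adds an independent difference, so at most [d] extensions are possible. *)
Lemma pairing_coset S n :
    size S = (n.*2 + 1)%N -> (d <= n)%N ->
  exists P R v, pairing S P R /\ {in S, forall x, x + v \in <<differences P>>%VS}.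
Proof.
move=> sS dn.
suff H k P R : pairing S P R -> (d - size P < k)%N ->
    exists P R v, pairing S P R /\ {in S, forall x, x + v \in <<differences P>>%VS}.
  apply: (H d.+1 [::] S); last by rewrite ltnS leq_subr.
  by rewrite /pairing /= perm_refl nil_free.
elim: k P R => // k IHk P R SPR; rewrite ltnS => dPk.
have sP := pairing_leq_dim SPR; have sR := size_pairing SPR.
have [Pd|Pd] := eqVneq (size P) d.
  exists P, R, 0; split=> // x _.
  have /andP[_ /eqP fP] := SPR.
  suff -> : <<differences P>>%VS = fullv by rewrite memvf.
  by apply/eqP; rewrite eqEdim subvf fP dimvf /dim /= mul1n size_map Pd leqnn.
(* Fewer than [d <= n] pairs use at most [2n - 2] of the [2n + 1] terms. *)
have R_gt2 : (2 < size R)%N by lia.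
have [[P' [R' [SPR' sP']]]|[v vP]] := pairing_extend SPR R_gt2.
- by apply: (IHk P' R' SPR'); lia.
- by exists P, R, v.
Qed.

(** Over ['F_2], [w] is a sum of some of the differences; switching from [p.1] to [p.2] in exactly
    those pairs adds [w]. The bound on multiplicities later allows [L] to be realised inside [S]. *)
Lemma choose_from_pairs P w :
    w \in <<differences P>>%VS ->
  exists L, [/\ size L = size P, \sum_(x <- L) x = \sum_(p <- P) p.1 + w
    & forall x, (count_mem x L <= count_mem x (unzip1 P ++ unzip2 P))%N].
Proof.
elim: P w => [|p P IHP] w.
  rewrite /= span_nil memv0 => /eqP ->.
  by exists [::]; split; rewrite ?big_nil ?addr0.
case/mem_span_cons=> /IHP[L [sL SL cL]].
  exists (p.1 :: L); split; rewrite /= ?sL //.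
    by rewrite !big_cons SL addrA.
  by move=> x; have := cL x; rewrite /= !count_cat /=; lia.
exists (p.2 :: L); split; rewrite /= ?sL //.
  by rewrite !big_cons SL addrCA -!addrA [p.2 + _]addrCA addKvv addrCA.
by move=> x; have := cL x; rewrite /= !count_cat /=; lia.
Qed.

Lemma sum_coset (U : {vspace V}) S v :
  {in S, forall x, x + v \in U} -> \sum_(x <- S) x + v *+ size S \in U.
Proof.
elim: S => [|x S IHS] SU; first by rewrite big_nil mulr0n addr0 mem0v.
rewrite big_cons /= mulrS addrACA memvD ?SU ?mem_head //.
by apply: IHS => y yS; rewrite SU // inE yS orbT.
Qed.

Lemma zero_sum_subseq S n :
    size S = (n.*2 + 1)%N -> (d <= n)%N -> ~~ odd n ->
  exists T, [/\ subseq T S, size T = n & \sum_(x <- T) x = 0].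
Proof.
move=> sS dn n_even.
have [P [R [v [SPR SW]]]] := pairing_coset sS dn.
have sP := pairing_leq_dim SPR; have sR := size_pairing SPR.
have /andP[SP _] := SPR; set W := <<_>>%VS in SW.
pose K := take (n - size P) R.
have sK : size (unzip1 P ++ K) = n by rewrite size_cat size_map size_takel; lia.
have TW : \sum_(x <- unzip1 P ++ K) x \in W.
  (* As [n] is even, the [n] copies of [v] cancel. *)
  have <- : \sum_(x <- unzip1 P ++ K) x + v *+ size (unzip1 P ++ K) =
            \sum_(x <- unzip1 P ++ K) x.
    by rewrite sK -(even_halfK n_even) -mul2n mulrnA mulr2n addvv mul0rn addr0.
  apply: sum_coset => x; rewrite mem_cat => xPK; apply: SW.
  rewrite (perm_mem SP) !mem_cat; case/orP: xPK => [-> //|/mem_take ->].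
  by rewrite !orbT.
(* The sum to be cancelled is itself taken as [w], so that [L ++ K] sums to [w + w = 0]. *)
have [L [sL SL cL]] := choose_from_pairs TW.
have /count_subseqP[T TS LT] : forall x, (count_mem x (L ++ K) <= count_mem x S)%N.
  move=> x; rewrite (permP SP) catA (count_cat _ L) (count_cat _ (_ ++ _)) leq_add //.
  by rewrite -[in leqRHS](cat_take_drop (n - size P) R) count_cat leq_addr.
exists T; split=> //.
  by rewrite -(perm_size LT) size_cat sL -[size P](size_map fst) -size_cat.
rewrite -(perm_big _ LT) /= big_cat /= SL big_cat /= big_map.
by rewrite addKvv addvv.
Qed.

Definition extremal_seq (k : nat) : seq V :=
  nseq k 0 ++ const_mx 1 :: [seq delta_mx 0 i | i <- enum 'I_d].

Lemma sum_delta_mx (J : seq 'I_d) (i : 'I_d) :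
  uniq J -> (\sum_(x <- [seq delta_mx 0 j | j <- J]) x : V) 0 i = (i \in J)%:R.
Proof.
move=> uJ; rewrite big_map summxE -count_uniq_mem // -sum1_count natr_sum.
by rewrite [RHS]big_mkcond; apply: eq_bigr => j _; rewrite mxE eqxx eq_sym /=; case: eqP.
Qed.

(** Coordinate [i] of the sum is the indicator of the [i]-th unit vector being chosen, plus 1 if the
    all-ones vector is. For it to vanish everywhere, either only zeros are chosen, or the all-ones
    vector and all [d] unit vectors are. *)
Lemma extremal_seq_zero_sum k T :
    subseq T (extremal_seq k) -> \sum_(x <- T) x = 0 ->
  (size T <= k)%N \/ (d < size T)%N.
Proof.
case/subseqP=> b; rewrite /extremal_seq size_cat size_nseq /= => sb ->.
have szk : size (take k b) = size (nseq k (0 : V)).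
  by rewrite size_nseq size_takel // sb leq_addr.
rewrite -(cat_take_drop k b) mask_cat // size_cat big_cat /=.
set Z := mask _ (nseq k _).
have sZ : (size Z <= k)%N.
  by rewrite -[leqRHS](size_nseq k (0 : V)) size_subseq ?mask_subseq.
have -> : \sum_(x <- Z) x = 0.
  by apply: big1_seq => x /= /mem_mask; rewrite mem_nseq => /andP[_ /eqP].
rewrite add0r.
case: (drop k b) => [|c b']; first by left; rewrite addn0.
rewrite mask_cons -map_mask; set J := mask b' _.
have uJ : uniq J by rewrite mask_uniq ?enum_uniq.
rewrite size_cat size_nseq size_map big_cat /= big_nseq.
move/rowP => HJ; case: c HJ => HJ; last first.
  left; suff -> : J = [::] by rewrite !addn0.
  case: J uJ HJ => // j J uJ /(_ j).
  by rewrite mxE sum_delta_mx // !mxE mem_head add0r.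
right; suff : #|'I_d| = size J by rewrite card_ord; lia.
rewrite cardT; apply/perm_size/uniq_perm; rewrite ?enum_uniq // => i.
rewrite mem_enum inE; move: (HJ i); rewrite mxE sum_delta_mx // !mxE.
by case: (i \in J).
Qed.

End PairedSequences.

Theorem theorem11 (m : nat) (hm : 0 < m) : s2m m (2 * m) = 4 * m + 1.
Proof.
rewrite /s2m; case: ex_minnP => n /forallP Hn min_n; apply/eqP; rewrite eqn_leq.
apply/andP; split.
  apply/min_n/forallP => S; apply/existsP.
  have [||T [TS sT T0]] := @zero_sum_subseq (2 * m) S (2 * m) _ (leqnn _).
  - by rewrite size_tuple; lia.
  - by rewrite mul2n odd_double.
  - by exists (Tuple (introT eqP sT)); rewrite /= TS T0 eqxx.
rewrite leqNgt; apply/negP => n_small.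
(* The full sequence has [(2m - 1) + 1 + 2m = 4m] terms, hence a prefix of length [n]; a zero-sum
   subsequence of length [2m] would need [2m <= 2m - 1] or [2m < 2m]. *)
have sS : size (take n (extremal_seq (2 * m) (2 * m).-1)) == n.
  rewrite size_takel // size_cat size_nseq /= size_map size_enum_ord; lia.
have /existsP[T /andP[TS /eqP T0]] := Hn (Tuple sS).
have [] := extremal_seq_zero_sum (subseq_trans TS (take_subseq _ _)) T0;
  rewrite size_tuple; lia.
Qed.
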